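(* Let $D$ be a divisor on $Y$. Then after finitely many steps of the unloading procedure applied to $D$ one reaches the $\pi$-antieffective closure of $D$.
   Context: Let $k$ be an algebraically closed field of characteristic zero and $R$ a regular local ring over $k$ of dimension at least $2$ such that $X=\operatorname{Spec} R$ is the germ of a smooth algebraic variety over $k$. Let $\mathfrak a$ be a (nonzero) ideal sheaf on $X$ and let $\pi:Y\to X$ be a fixed log resolution of $(X,\mathfrak a)$: a proper birational morphism with $Y$ smooth, $\mathfrak a\cdot\mathcal O_Y=\mathcal O_Y(-F)$ for an effective Cartier divisor $F$, and $F+\mathrm{Exc}(\pi)$ a simple normal crossing divisor. ''Divisor'' means divisor with integer coefficients. A divisor $D$ on $Y$ is $\pi$-antieffective if $H^0(E,\mathcal O_Y(-D)|_E)\neq0$ for every $\pi$-exceptional prime divisor $E$. The $\pi$-antieffective closure of $D$ is the unique $\pi$-antieffective divisor $\tilde D\geqslant D$ such that $D'\geqslant\tilde D$ for every $\pi$-antieffective divisor $D'\geqslant D$ (it always exists). Unloading procedure: if $D$ is not $\pi$-antieffective, there is at least one $\pi$-exceptional prime divisor $E$ with $H^0(E,\mathcal O_Y(-D)|_E)=0$; a step of unloading consists in choosing any such $E$ and replacing $D$ by $D+E$. This is repeated until the obtained divisor is $\pi$-antieffective. *)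

(* Defs.v *)
From HB Require Import structures.
From mathcomp Require Import all_boot all_order all_algebra.
From mathcomp Require Import all_classical topology.

Set Implicit Arguments.
Unset Strict Implicit.
Unset Printing Implicit Defensive.

Import Order.TTheory GRing.Theory Num.Theory.

Local Open Scope classical_set_scope.
Local Open Scope ring_scope.

(** * Commutative algebra *)

Definition ideal (A : comUnitRingType) (I : set A) : Prop :=
  [/\ I 0, (forall x y, I x -> I y -> I (x + y)) & (forall c x, I x -> I (c * x))].

Definition ideal_span (A : comUnitRingType) (S : set A) : set A :=
  [set z | exists n (c s : 'I_n -> A),
     (forall i, S (s i)) /\ z = \sum_(i < n) c i * s i].

Definition prime_ideal (A : comUnitRingType) (p : set A) : Prop :=
  [/\ ideal p, ~ p 1 & forall x y, p (x * y) -> p x \/ p y].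

Definition noetherian (A : comUnitRingType) : Prop :=
  forall I : set A, ideal I ->
    exists n (x : 'I_n -> A), I = ideal_span (range x).

Definition domain (A : comUnitRingType) : Prop :=
  forall x y : A, x * y = 0 -> x = 0 \/ y = 0.

Definition local_ring (A : comUnitRingType) : Prop :=
  forall x y : A, x \isn't a GRing.unit -> y \isn't a GRing.unit ->
    x + y \isn't a GRing.unit.

(* The maximal ideal, when A is local. *)
Definition nonunits (A : comUnitRingType) : set A :=
  [set x | x \isn't a GRing.unit].
Arguments nonunits : clear implicits.

(* A chain p_0 < p_1 < ... < p_n of prime ideals. *)
Definition prime_chain (A : comUnitRingType) (n : nat) : Prop :=
  exists p : nat -> set A,
    (forall i, (i <= n)%N -> prime_ideal (p i)) /\
    (forall i, (i < n)%N -> p i `<` p i.+1).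

Definition krull_dim (A : comUnitRingType) (n : nat) : Prop :=
  prime_chain A n /\ ~ prime_chain A n.+1.

Definition regular_parameters (A : comUnitRingType) (d : nat) (x : 'I_d -> A) :
    Prop :=
  krull_dim A d /\ nonunits A = ideal_span (range x).

Definition regular_local_ring (A : comUnitRingType) : Prop :=
  [/\ local_ring A, noetherian A &
      exists d (x : 'I_d -> A), regular_parameters x].

(* The ring homomorphism f : A -> L identifies L with the localization A_p. *)
Definition is_localization (A L : comUnitRingType) (p : set A) (f : A -> L) :
    Prop :=
  [/\ (forall a, ~ p a -> f a \is a GRing.unit),
      (forall z, exists a b, ~ p b /\ z * f b = f a) &
      (forall a, f a = 0 -> exists c, ~ p c /\ c * a = 0)].

(* A is generated as a B-algebra by finitely many elements, through h. *)
Definition finitely_generated (B A : comUnitRingType) (h : B -> A) : Prop :=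
  exists n (x : 'I_n -> A), forall S : set A,
    S 1 -> (forall a b, S a -> S b -> S (a - b)) ->
    (forall a b, S a -> S b -> S (a * b)) ->
    (forall b, S (h b)) -> (forall i, S (x i)) -> forall a, S a.

(* R is the local ring at a point of a smooth variety over k, taken affine
   without loss of generality. Since k is perfect in the intended use
   (algebraically closed of characteristic 0), smooth over k means regular. *)
Definition smooth_germ (k : closedFieldType) (R : comUnitAlgType k) : Prop :=
  exists (B : comUnitAlgType k) (p : set B) (loc : {lrmorphism B -> R}),
    [/\ domain B, finitely_generated (fun c : k => c%:A : B),
        (forall (q : set B) (L : comUnitRingType) (f : {rmorphism B -> L}),
           prime_ideal q -> is_localization q f -> regular_local_ring L),
        prime_ideal p & is_localization p loc].

(** * Schemes *)

(* Locally ringed spaces, the structure sheaf being presented by its espace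
   étalé: stalks, together with the predicate [section_at x s] saying that the
   family of germs s is, on some neighbourhood of x, a section of the sheaf.
   The sections over an open U are the families s with [section_at x s] for all
   x in U, two of them being identified when they agree on U.
   Stalks are comUnitRingType rather than comNzRingType only so that the
   library's predicate GRing.unit is available. *)
Record lrspace := LRSpace {
  points :> topologicalType;
  stalk : points -> comUnitRingType;
  section_at : forall x : points, (forall y, stalk y) -> Prop;
  stalk_local : forall x, local_ring (stalk x);
  section_near : forall x s, section_at x s -> \forall y \near x, section_at y s;
  section_ext : forall x s t, section_at x s ->
    (\forall y \near x, s y = t y) -> section_at x t;
  section_exists : forall x (a : stalk x), exists2 s, section_at x s & s x = a;
  section_germ : forall x s t, section_at x s -> section_at x t ->
    s x = t x -> \forall y \near x, s y = t y;
  section_1 : forall x, section_at x (fun=> 1);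
  section_sub : forall x s t, section_at x s -> section_at x t ->
    section_at x (fun y => s y - t y);
  section_mul : forall x s t, section_at x s -> section_at x t ->
    section_at x (fun y => s y * t y)
}.
Arguments stalk : clear implicits.
Arguments section_at {_} _ _.

(* chi a is the section over U defined by a : A, and chi identifies U with
   Spec A as a locally ringed space; the values of chi a outside U are junk. *)
Definition affine_chart (X : lrspace) (U : set X) (A : comUnitRingType)
    (chi : A -> forall x : X, stalk X x) : Prop :=
  open U /\
  (forall x, U x ->
     [/\ zmod_morphism (fun a => chi a x), monoid_morphism (fun a => chi a x) &
         forall a, section_at x (chi a)]) /\
  (forall p, prime_ideal p <->
     exists2 x, U x & p = [set a | chi a x \isn't a GRing.unit]) /\
  (forall x y, U x -> U y ->
     (forall a, (chi a x \is a GRing.unit) = (chi a y \is a GRing.unit)) ->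
     x = y) /\
  (forall x V, U x -> nbhs x V -> exists a, chi a x \is a GRing.unit /\
     forall y, U y -> chi a y \is a GRing.unit -> V y) /\
  (forall x, U x -> is_localization [set a | chi a x \isn't a GRing.unit]
                                    (fun a => chi a x)).

Definition scheme (X : lrspace) : Prop :=
  forall x : X, exists (U : set X) (A : comUnitRingType)
    (chi : A -> forall x, stalk X x), U x /\ affine_chart U chi.

(* Every affine open is nonempty here: comUnitRingType excludes the zero ring. *)
Definition integral_scheme (X : lrspace) : Prop :=
  [set: X] !=set0 /\
  forall (U : set X) (A : comUnitRingType) (chi : A -> forall x, stalk X x),
    affine_chart U chi -> domain A.

Definition regular_scheme (X : lrspace) : Prop :=
  (forall x : X, exists (U : set X) (A : comUnitRingType)
     (chi : A -> forall x, stalk X x),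
     [/\ U x, affine_chart U chi & noetherian A]) /\
  (forall x : X, regular_local_ring (stalk X x)).

Definition generic_point (X : lrspace) (eta : X) : Prop :=
  closure [set eta] = [set: X].

Record morphism (Y X : lrspace) := Morphism {
  mor_fun :> Y -> X;
  mor_stalk : forall y, {rmorphism stalk X (mor_fun y) -> stalk Y y};
  mor_continuous : continuous mor_fun;
  mor_local : forall y a, mor_stalk y a \is a GRing.unit -> a \is a GRing.unit;
  mor_section : forall y s, section_at (mor_fun y) s ->
    section_at y (fun z => mor_stalk z (s (mor_fun z)))
}.
Arguments mor_stalk {Y X} _ _.

Definition mor_id (X : lrspace) : morphism X X :=
  @Morphism X X id (fun y => (idfun : {rmorphism stalk X y -> stalk X y}))
    (fun y => cvg_id) (fun y a h => h) (fun y s h => h).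

Lemma mor_comp_continuous (Z Y X : lrspace) (f : morphism Y X)
  (g : morphism Z Y) : continuous (fun z => f (g z)).
Proof.
by move=> z; apply: continuous_comp; exact: mor_continuous.
Qed.

Definition mor_comp (Z Y X : lrspace) (f : morphism Y X) (g : morphism Z Y) :
    morphism Z X :=
  @Morphism Z X (fun z => f (g z))
    (fun z => (mor_stalk g z \o mor_stalk f (g z))%FUN)
    (mor_comp_continuous (f := f) (g := g))
    (fun z a h => mor_local (mor_local h))
    (fun z s h => mor_section (mor_section h)).

(* Equality of morphisms. Letting s range over families of germs avoids a
   transport between stalk X (f y) and stalk X (g y). *)
Definition mor_eq (Y X : lrspace) (f g : morphism Y X) : Prop :=
  forall y, f y = g y /\
    forall s : (forall x, stalk X x),
      mor_stalk f y (s (f y)) = mor_stalk g y (s (g y)).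

(* P, with projections p and q, is the fibre product of f and g. *)
Definition fibre_product (X Y T P : lrspace) (f : morphism Y X)
    (g : morphism T X) (p : morphism P Y) (q : morphism P T) : Prop :=
  [/\ scheme P, mor_eq (mor_comp f p) (mor_comp g q) &
    forall (Z : lrspace) (u : morphism Z Y) (v : morphism Z T), scheme Z ->
      mor_eq (mor_comp f u) (mor_comp g v) ->
      exists w : morphism Z P,
        [/\ mor_eq (mor_comp p w) u, mor_eq (mor_comp q w) v &
          forall w' : morphism Z P, mor_eq (mor_comp p w') u ->
            mor_eq (mor_comp q w') v -> mor_eq w' w]].

Definition closed_map (Y X : lrspace) (f : morphism Y X) : Prop :=
  forall C : set Y, closed C -> closed (f @` C).

Definition closed_immersion (Y X : lrspace) (f : morphism Y X) : Prop :=
  [/\ injective f, closed_map f &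
      forall y b, exists a, mor_stalk f y a = b].

Definition separated_morphism (Y X : lrspace) (f : morphism Y X) : Prop :=
  forall (P : lrspace) (p q : morphism P Y) (diag : morphism Y P),
    fibre_product f f p q ->
    mor_eq (mor_comp p diag) (mor_id Y) ->
    mor_eq (mor_comp q diag) (mor_id Y) -> closed_immersion diag.

Definition universally_closed (Y X : lrspace) (f : morphism Y X) : Prop :=
  forall (T P : lrspace) (g : morphism T X) (p : morphism P Y)
    (q : morphism P T), scheme T -> fibre_product f g p q -> closed_map q.

Definition finite_type (Y X : lrspace) (f : morphism Y X) : Prop :=
  forall x : X, exists (U : set X) (B : comUnitRingType)
    (psi : B -> forall x, stalk X x), [/\ U x, affine_chart U psi &
    exists (n : nat) (V : 'I_n -> set Y) (A : 'I_n -> comUnitRingType)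
      (chi : forall i, A i -> forall y, stalk Y y)
      (h : forall i, {rmorphism B -> A i}),
      f @^-1` U = \bigcup_i V i /\
      forall i, [/\ affine_chart (V i) (chi i), finitely_generated (h i) &
        forall y b, V i y -> chi i (h i b) y = mor_stalk f y (psi b (f y))]].

Definition proper_morphism (Y X : lrspace) (f : morphism Y X) : Prop :=
  [/\ separated_morphism f, finite_type f & universally_closed f].

(* For integral schemes with eta the generic point of Y: the generic point goes
   to the generic point and the function fields are identified. *)
Definition birational (Y X : lrspace) (f : morphism Y X) (eta : Y) : Prop :=
  generic_point (f eta) /\ bijective (mor_stalk f eta).

(** * Divisors

    From here on, Y is an integral scheme with generic point eta, so that
    stalk Y eta is its function field. Integral closed subschemes are
    represented by their generic points. *)

Definition prime_divisor (Y : lrspace) (P : Y) : Prop := krull_dim (stalk Y P) 1.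

(* The germ a at y, viewed as the rational function f. *)
Definition germ_fraction (Y : lrspace) (eta y : Y) (a : stalk Y y)
    (f : stalk Y eta) : Prop :=
  exists s, [/\ section_at y s, s y = a & s eta = f].

(* ord_P(f) = m: f = u t^m for a uniformizer t and a unit u of the local ring
   at P, where t^m is read as t^i / t^j with m = i - j. *)
Definition ord_eq (Y : lrspace) (eta P : Y) (f : stalk Y eta) (m : int) : Prop :=
  exists (t u : stalk Y P) (t' u' : stalk Y eta) (i j : nat),
    [/\ nonunits (stalk Y P) = ideal_span [set t], u \is a GRing.unit,
        germ_fraction t t', germ_fraction u u' &
        f * t' ^+ j = u' * t' ^+ i /\ m = i%:Z - j%:Z].

Definition ord_ge (Y : lrspace) (eta P : Y) (f : stalk Y eta) (n : int) : Prop :=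
  f = 0 \/ exists2 m, ord_eq P f m & n <= m.

Definition is_divisor (Y : lrspace) (D : Y -> int) : Prop :=
  finite_set [set P | D P != 0] /\ forall P, D P != 0 -> prime_divisor P.

Definition effective (Y : lrspace) (D : Y -> int) : Prop := forall P, 0 <= D P.

Definition div_le (Y : lrspace) (D D' : Y -> int) : Prop :=
  forall P, D P <= D' P.

Definition div_add (Y : lrspace) (D D' : Y -> int) : Y -> int :=
  fun P => D P + D' P.

(* The divisor 1 * E. *)
Definition div_prime (Y : lrspace) (E : Y) : Y -> int := fun P => (P == E)%:R.

(* The sections over V, then the stalk at y, of the subsheaf O_Y(-D) of the
   constant sheaf of rational functions. *)
Definition OYN_sections (Y : lrspace) (eta : Y) (D : Y -> int) (V : set Y) :
    set (stalk Y eta) :=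
  [set f | forall P, V P -> prime_divisor P -> ord_ge P f (D P)].

Definition OYN_stalk (Y : lrspace) (eta : Y) (D : Y -> int) (y : Y) :
    set (stalk Y eta) :=
  [set f | exists V, [/\ open V, V y & OYN_sections D V f]].

Definition cartier (Y : lrspace) (eta : Y) (D : Y -> int) : Prop :=
  forall y, exists (V : set Y) (phi : stalk Y eta),
    [/\ open V, V y, phi \is a GRing.unit &
        forall z, V z -> forall f, OYN_stalk D z f <->
          exists (c : stalk Y z) c', germ_fraction c c' /\ f = c' * phi].

(* The stalk at y of the ideal sheaf of the reduced subscheme closure {E}. *)
Definition prime_ideal_stalk (Y : lrspace) (E y : Y) : set (stalk Y y) :=
  [set a | exists s, [/\ section_at y s, s y = a &
     \forall z \near y, closure [set E] z -> s z \isn't a GRing.unit]].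

(* The stalk at y of I_E * O_Y(-D), where I_E is the ideal sheaf of E. *)
Definition prime_ideal_OYN_stalk (Y : lrspace) (eta : Y) (E : Y) (D : Y -> int)
    (y : Y) : set (stalk Y eta) :=
  [set f | exists n (a : 'I_n -> stalk Y y) (a' l : 'I_n -> stalk Y eta),
    (forall i, [/\ prime_ideal_stalk E (a i), germ_fraction (a i) (a' i) &
                   OYN_stalk D y (l i)]) /\
    f = \sum_(i < n) a' i * l i].

(* Global sections over E of O_Y(-D)|_E = O_Y(-D) / I_E O_Y(-D): tau y is a
   representative of the germ at y, only its class modulo the stalk of
   I_E O_Y(-D) being meaningful, and only for y in closure {E}. *)
Definition restricted_section (Y : lrspace) (eta : Y) (E : Y) (D : Y -> int)
    (tau : Y -> stalk Y eta) : Prop :=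
  forall y, closure [set E] y -> exists (V : set Y) (f : stalk Y eta),
    [/\ open V, V y, OYN_sections D V f &
        forall z, V z -> closure [set E] z ->
          prime_ideal_OYN_stalk E D z (tau z - f)].

(* H^0(E, O_Y(-D)|_E) <> 0. *)
Definition H0_nonzero (Y : lrspace) (eta : Y) (E : Y) (D : Y -> int) : Prop :=
  exists2 tau : Y -> stalk Y eta, restricted_section E D tau &
    exists2 y, closure [set E] y & ~ prime_ideal_OYN_stalk E D y (tau y).

(** * Log resolutions *)

(* pi restricts to an open immersion on a neighbourhood of y. *)
Definition local_iso_at (Y X : lrspace) (pi : morphism Y X) (y : Y) : Prop :=
  exists V : set Y, [/\ open V, V y, {in V &, injective pi},
    (forall W, W `<=` V -> open W -> open (pi @` W)) &
    forall z, V z -> bijective (mor_stalk pi z)].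

Definition exceptional_locus (Y X : lrspace) (pi : morphism Y X) : set Y :=
  [set y | ~ local_iso_at pi y].

Definition exceptional_prime (Y X : lrspace) (pi : morphism Y X) (E : Y) : Prop :=
  prime_divisor E /\ closure [set E] `<=` exceptional_locus pi.

(* Exc(pi) as a reduced divisor. *)
Definition exceptional_divisor (Y X : lrspace) (pi : morphism Y X) : Y -> int :=
  fun P => `[< exceptional_prime pi P >]%:R.

Definition exceptional_locus_is_divisor (Y X : lrspace) (pi : morphism Y X) :
    Prop :=
  is_divisor (exceptional_divisor pi) /\
  exceptional_locus pi =
    \bigcup_(E in exceptional_prime pi) closure [set E].

(* At every point, the components through it are coordinate hyperplanes of one
   system of local coordinates; distinct components get distinct coordinates
   because the ideal at y of a component through y determines it. *)
Definition simple_normal_crossing (Y : lrspace) (D : Y -> int) : Prop :=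
  is_divisor D /\
  forall y, exists d (x : 'I_d -> stalk Y y), regular_parameters x /\
    forall P, D P != 0 -> closure [set P] y ->
      exists i, prime_ideal_stalk P (y := y) = ideal_span [set x i].

(* a * O_Y = O_Y(-F), for a an ideal of R and X = Spec R through chi. *)
Definition inverse_image_ideal_eq (R : comUnitRingType) (Y X : lrspace)
    (chi : R -> forall x, stalk X x) (a : set R) (pi : morphism Y X) (eta : Y)
    (F : Y -> int) : Prop :=
  forall y (f : stalk Y eta), OYN_stalk F y f <->
    exists2 g : stalk Y y,
      ideal_span [set mor_stalk pi y (chi r (pi y)) | r in a] g &
      germ_fraction g f.

Definition log_resolution (R : comUnitRingType) (Y X : lrspace)
    (chi : R -> forall x, stalk X x) (a : set R) (pi : morphism Y X) (eta : Y) :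
    Prop :=
  [/\ proper_morphism pi, birational pi eta, regular_scheme Y,
      exceptional_locus_is_divisor pi &
      exists F : Y -> int,
        [/\ is_divisor F, effective F, cartier eta F,
            inverse_image_ideal_eq chi a pi eta F &
            simple_normal_crossing (div_add F (exceptional_divisor pi))]].

(** * Antieffective divisors and unloading *)

Definition antieffective (Y X : lrspace) (pi : morphism Y X) (eta : Y)
    (D : Y -> int) : Prop :=
  forall E, exceptional_prime pi E -> H0_nonzero eta E D.

Definition antieffective_closure (Y X : lrspace) (pi : morphism Y X) (eta : Y)
    (D Dt : Y -> int) : Prop :=
  [/\ is_divisor Dt, antieffective pi eta Dt, div_le D Dt &
      forall D', is_divisor D' -> antieffective pi eta D' -> div_le D D' ->
        div_le Dt D'].

Definition unloading_step (Y X : lrspace) (pi : morphism Y X) (eta : Y)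
    (D D' : Y -> int) : Prop :=
  exists E, [/\ exceptional_prime pi E, ~ H0_nonzero eta E D &
                D' = div_add D (div_prime E)].

(* Ds is a run of the unloading procedure, with arbitrary choices; its terms
   after the first antieffective one are irrelevant. *)
Definition unloading_run (Y X : lrspace) (pi : morphism Y X) (eta : Y)
    (Ds : nat -> Y -> int) : Prop :=
  forall i, ~ antieffective pi eta (Ds i) ->
    unloading_step pi eta (Ds i) (Ds i.+1).

(* Main.v *)
Require Import Defs.
From HB Require Import structures.
From mathcomp Require Import all_boot all_order all_algebra.
From mathcomp Require Import all_classical topology.
From mathcomp Require Import ring zify.

Set Implicit Arguments.
Unset Strict Implicit.
Unset Printing Implicit Defensive.

Import Order.TTheory GRing.Theory Num.Theory.

Local Open Scope classical_set_scope.
Local Open Scope ring_scope.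

(* If D <= D', D' is antieffective and H^0(E, O(-D)|_E) = 0, then D E < D' E:
   otherwise the inclusion O(-D') <= O(-D), an isomorphism at the generic point
   of E, would carry a nonzero section of O(-D')|_E to a nonzero section of
   O(-D)|_E.  Nonvanishing at the generic point of E holds because I_E is
   locally principal by the normal crossing hypothesis, so that
   I_E O(-D') = O(-D' - E).  Hence unloading stays below every antieffective
   divisor above D, and it stops as soon as one such divisor exists.  For that,
   take a nonzero global function f pulled back from X with ord_P f >= D P on
   the support of D, and let D' P = ord_P f on that support and on the
   exceptional primes, and 0 elsewhere: f is a section of O(-D') that does not
   vanish identically on any exceptional E. *)

(** * Uniformizers and discrete valuation rings *)

Definition uniformizer (A : comUnitRingType) (t : A) : Prop :=
  nonunits A = ideal_span [set t].

Definition discrete_valuation_ring (A : comUnitRingType) (t : A) : Prop :=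
  [/\ uniformizer t, t != 0 &
      forall x, x != 0 -> exists u n, u \is a GRing.unit /\ x = u * t ^+ n].

Lemma ideal_span1P (A : comUnitRingType) (t z : A) :
  ideal_span [set t] z <-> exists c, z = c * t.
Proof.
split=> [[n [c [s [st ->]]]]|[c ->]]; last first.
  exists 1%N, (fun=> c), (fun=> t); split=> //.
  by rewrite big_ord_recl big_ord0 addr0.
exists (\sum_i c i); rewrite mulr_suml; apply: eq_bigr => i _.
by rewrite (st i).
Qed.

Lemma ideal_sum (A : comUnitRingType) (I : set A) n (x : 'I_n -> A) :
  ideal I -> (forall i, I (x i)) -> I (\sum_i x i).
Proof. by move=> [I0 ID _] Ix; apply: (big_ind I). Qed.

Lemma uniformizerP (A : comUnitRingType) (t z : A) : uniformizer t ->
  z \isn't a GRing.unit <-> exists c, z = c * t.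
Proof.
move=> tU; have : nonunits A z <-> ideal_span [set t] z by rewrite tU.
by rewrite ideal_span1P.
Qed.

Lemma uniformizer_nonunit (A : comUnitRingType) (t : A) :
  uniformizer t -> t \isn't a GRing.unit.
Proof. by move=> tU; apply/(uniformizerP _ tU); exists 1; rewrite mul1r. Qed.

Lemma prime_chain_le (A : comUnitRingType) m n :
  (m <= n)%N -> prime_chain A n -> prime_chain A m.
Proof.
move=> mn [p [pP pS]]; exists p; split=> i im; last exact/pS/(leq_trans im).
exact/pP/(leq_trans im).
Qed.

Lemma krull_dim_uniq (A : comUnitRingType) m n :
  krull_dim A m -> krull_dim A n -> m = n.
Proof.
wlog lemn : m n / (m <= n)%N => [H Am An|[_ Am1] [An _]].
  by case: (leqP m n) => [|/ltnW] mn; [|apply/esym]; exact: H.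
apply/eqP; rewrite eqn_leq lemn leqNgt; apply/negP => mn.
exact/Am1/(prime_chain_le mn).
Qed.

Lemma local_ring_sub1_unit (A : comUnitRingType) (x : A) :
  local_ring A -> x \isn't a GRing.unit -> 1 - x \is a GRing.unit.
Proof.
move=> Aloc xNU; apply: contraT => H.
by have := Aloc _ _ xNU H; rewrite addrC subrK unitr1.
Qed.

(* If [a] were divisible by every power of [t], generators of the ideal
   (a : t^oo) would give [N] with [(a : t^oo) = (a : t^N)]; writing
   [a = b t^(N+1)] then yields [b t^N (1 - c t) = 0]. *)
Lemma dim1_regular_dvr (A : comUnitRingType) :
  regular_local_ring A -> krull_dim A 1 ->
  exists t : A, discrete_valuation_ring t.
Proof.
move=> [Aloc Anoe [d [x [Ad xm]]]] A1.
have d1 := krull_dim_uniq Ad A1; subst d.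
exists (x ord0); have tU : uniformizer (x ord0).
  rewrite /uniformizer xm; congr ideal_span.
  apply/seteqP; split=> [z [i _ <-]|z ->].
    by rewrite (ord1 i).
  by exists ord0.
set t := x ord0 in tU *.
split=> // [|a a0].
  (* If [t] were 0, then 0 would be the only nonunit, and no prime ideal could lie strictly above
     [p 0]. *)
  case: A1 => [[p [pP pS]] _].
  apply/eqP => t0.
  have [[p0 _ _] _ _] := pP 0%N isT; have [[_ _ pM] p1 _] := pP 1%N isT.
  have [_] := pS 0%N isT; apply=> z pz.
  have [zU|/(uniformizerP _ tU)[c ->]] := boolP (z \is a GRing.unit).
    by exfalso; apply/p1; rewrite -(mulVr zU); exact: pM.
  by rewrite t0 mulr0.
apply: contrapT => aN.
have adiv n : exists b, a = b * t ^+ n.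
  elim: n => [|n [b ab]]; first by exists a; rewrite mulr1.
  have [bU|/(uniformizerP _ tU)[c bc]] := boolP (b \is a GRing.unit).
    by exfalso; apply: aN; exists b, n.
  by exists c; rewrite ab bc exprS mulrA.
pose I := [set z | exists n c, z * t ^+ n = c * a].
have II : ideal I.
  split=> [|y z [n [c yc]] [m [e ze]]|c z [n [e ze]]].
  - by exists 0%N, 0; rewrite !mul0r.
  - exists (n + m)%N, (c * t ^+ m + e * t ^+ n).
    rewrite exprD mulrDl mulrA yc mulrDl; congr (_ + _); first by rewrite mulrAC.
    by rewrite (mulrC (t ^+ n)) mulrA ze mulrAC.
  - by exists n, (c * e); rewrite -!mulrA ze.
have [n [g Ig]] := Anoe I II.
have gI i : I (g i).
  rewrite Ig; exists 1%N, (fun=> 1), (fun=> g i); split; first by exists i.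
  by rewrite big_ord_recl big_ord0 addr0 mul1r.
have {gI}[k gk] := choice gI.
pose N := (\max_i k i)%N.
have IN z : I z -> exists c, z * t ^+ N = c * a.
  rewrite Ig => -[m [c [s [sg ->]]]].
  have sN i : exists e, s i * t ^+ N = e * a.
    have [j _ <-] := sg i; have [e je] := gk j.
    have jN : (k j <= N)%N by exact: leq_bigmax.
    exists (e * t ^+ (N - k j)).
    by rewrite -(subnKC jN) exprD mulrA je addKn mulrAC.
  have {sN}[e se] := choice sN.
  exists (\sum_i c i * e i); rewrite !mulr_suml; apply: eq_bigr => i _.
  by rewrite -!mulrA se.
have [b ab] := adiv N.+1.
have [|c bc] := IN b; first by exists N.+1, 1; rewrite mul1r.
have ctU : 1 - c * t \is a GRing.unit.
  by apply: local_ring_sub1_unit => //; apply/(uniformizerP _ tU); exists c.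
have bt0 : b * t ^+ N = 0.
  apply: (mulIr ctU); rewrite mul0r mulrBr mulr1 {1}bc ab exprSr.
  by apply/eqP; rewrite subr_eq0; apply/eqP; ring.
by move/eqP: a0; apply; rewrite ab exprSr mulrA bt0 mul0r.
Qed.

(** Serves to pass from the uniformizer [v * t] to [t]: once [t ^ n] is split off, only the
    nonnegative power [t ^+ k] remains, so the cofactor comes from the local ring. *)
Lemma rescale_power (K : comUnitRingType) (f u v t : K) (i j k : nat) (n : int) :
  v \is a GRing.unit -> t \is a GRing.unit -> i%:Z - j%:Z = k%:Z + n ->
  f * (v * t) ^+ j = u * (v * t) ^+ i ->
  f = u * v ^ (i%:Z - j%:Z) * t ^+ k * t ^ n.
Proof.
move=> vU tU ijE fE; have vtU : v * t \is a GRing.unit by rewrite unitrM vU.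
apply: (mulIr (unitrX j vtU)); rewrite fE [in LHS]exprnP.
have iE : (i : int) = (i%:Z - j%:Z) + j by rewrite subrK.
rewrite [in LHS]iE (exprzDr vtU) (exprMz_comm _ vU tU (mulrC _ _)).
by rewrite -exprnP {2}ijE (exprzDr tU) -exprnP !mulrA.
Qed.

(** * Germs and cospecialization maps between stalks *)

Lemma near_open (X : topologicalType) (x : X) (P : set X) :
  (\forall z \near x, P z) -> exists2 W, open W /\ W x & W `<=` P.
Proof.
move=> xP; have : nbhs x P by [].
by rewrite nbhsE => -[W Wx WP]; exists W.
Qed.

Lemma closure_point_near (X : topologicalType) (x y : X) (P : set X) :
  closure [set x] y -> (\forall z \near y, P z) -> P x.
Proof. by move=> xy Py; have [z [->]] := xy _ Py. Qed.

Definition germ_extension (X : lrspace) (y : X) (a : stalk X y) :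
  forall x, stalk X x := s2val (cid2 (section_exists a)).

Lemma germ_extension_section (X : lrspace) (y : X) (a : stalk X y) :
  section_at y (germ_extension a).
Proof. by rewrite /germ_extension; case: cid2. Qed.

Lemma germ_extensionE (X : lrspace) (y : X) (a : stalk X y) :
  germ_extension a y = a.
Proof. by rewrite /germ_extension; case: cid2. Qed.

(** The restriction map from the stalk at [y] to the stalk at its generization [x]. The chosen
    extension does not matter: two extensions agree near [y], and every neighbourhood of [y]
    contains [x]. *)
Definition cospecialization (X : lrspace) (x y : X)
  (xy : closure [set x] y) (a : stalk X y) : stalk X x := germ_extension a x.

Lemma cospecialization_section (X : lrspace) (x y : X)
    (xy : closure [set x] y) s :
  section_at y s -> cospecialization xy (s y) = s x.
Proof.
move=> sy; apply: (closure_point_near (P := fun x => _ x = s x) xy).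
by apply: section_germ; rewrite ?germ_extensionE//; exact: germ_extension_section.
Qed.

Section cospecialization_rmorphism.
Variables (X : lrspace) (x y : X) (xy : closure [set x] y).

Lemma cospecialization_is_zmod_morphism : zmod_morphism (cospecialization xy).
Proof.
move=> a b; rewrite -{1}(germ_extensionE a) -{1}(germ_extensionE b).
exact: (cospecialization_section _
  (section_sub (germ_extension_section a) (germ_extension_section b))).
Qed.

Lemma cospecialization_is_monoid_morphism :
  monoid_morphism (cospecialization xy).
Proof.
split=> [|a b]; first exact: (cospecialization_section _ (section_1 y)).
rewrite -{1}(germ_extensionE a) -{1}(germ_extensionE b).
exact: (cospecialization_section _
  (section_mul (germ_extension_section a) (germ_extension_section b))).
Qed.

HB.instance Definition _ := GRing.isZmodMorphism.Build _ _ (cospecialization xy)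
  cospecialization_is_zmod_morphism.
HB.instance Definition _ := GRing.isMonoidMorphism.Build _ _
  (cospecialization xy) cospecialization_is_monoid_morphism.
End cospecialization_rmorphism.

(** Turns the relation [germ_fraction] into the graph of a ring morphism, so that rational functions
    can be computed with algebraically. *)
Lemma germ_fractionP (X : lrspace) (x y : X) (xy : closure [set x] y) a f :
  germ_fraction a f <-> f = cospecialization xy a.
Proof.
split=> [[s [ys sy <-]]|->].
  by rewrite -sy cospecialization_section.
exists (germ_extension a); split=> //; first exact: germ_extension_section.
exact: germ_extensionE.
Qed.

(** A section extending the inverse of [s y] has product 1 with [s] at [y], hence near [y]. *)
Lemma section_unit_near (X : lrspace) (y : X) s : section_at y s ->
  s y \is a GRing.unit -> \forall z \near y, s z \is a GRing.unit.
Proof.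
move=> ys yU.
have vs := germ_extension_section (s y)^-1.
have := section_germ (section_mul ys vs) (section_1 y).
rewrite germ_extensionE divrr// => /(_ erefl); apply: filterS => z szv.
by apply/unitrPr; exists (germ_extension (s y)^-1 z).
Qed.

(** * The function field of an integral scheme *)

Section generic.
Variables (Y : lrspace) (eta : Y).
Hypotheses (Y_scheme : scheme Y) (Y_integral : integral_scheme Y).
Hypothesis eta_generic : generic_point eta.

Lemma generic_closure y : closure [set eta] y.
Proof. by rewrite eta_generic. Qed.
Arguments generic_closure : clear implicits.

(** The chart ring is a domain, so its zero ideal is the prime of some point [x] of [U]. A nonzero
    [a] is a unit at [x], hence near [x], hence at [eta]. *)
Lemma generic_chart_unit (U : set Y) (A : comUnitRingType)
    (chi : A -> forall x, stalk Y x) a :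
  affine_chart U chi -> U eta -> a != 0 -> chi a eta \is a GRing.unit.
Proof.
move=> Uchart Ueta a0; have Adom := Y_integral.2 _ _ _ Uchart.
have [Uo [Uh [Up [Uinj [Ub Uloc]]]]] := Uchart.
have [|x Ux x0] := (Up [set 0]).1.
  split=> [|/eqP|]; last exact: Adom; last by rewrite oner_eq0.
  by split=> [//|x y -> ->|c x ->]; rewrite ?addr0 ?mulr0.
have aU : chi a x \is a GRing.unit.
  apply: contrapT => aN; move/eqP: a0; apply.
  suff : [set a | chi a x \isn't a GRing.unit] a by rewrite -x0.
  exact/negP.
apply: (closure_point_near (P := fun z => chi a z \is a GRing.unit)
  (generic_closure x)).
by apply: section_unit_near => //; have [_ _] := Uh _ Ux; exact.
Qed.

Lemma function_field_unit (f : stalk Y eta) : f != 0 -> f \is a GRing.unit.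
Proof.
have [U [A [chi [Ueta Uchart]]]] := Y_scheme eta.
have [Uo [Uh [Up [Uinj [Ub Uloc]]]]] := Uchart.
move=> f0; have [_ /(_ f)[a [b [bN fab]]] _] := Uloc _ Ueta.
have bU : chi b eta \is a GRing.unit by apply/negPn/negP.
have a0 : a != 0.
  apply: contra_neq f0 => a0.
  apply: (mulIr bU); rewrite fab mul0r a0.
  have [Uz _ _] := Uh _ Ueta; have := Uz 0 0; rewrite subrr => ->.
  by rewrite subrr.
by have := generic_chart_unit Uchart Ueta a0; rewrite -fab unitrM => /andP[].
Qed.

(** Write the germ as [c / b] in a chart: a nonzero [c] would be a unit at [eta], where the germ
    maps to 0. *)
Lemma cospecialization_generic_eq0 (y : Y) (ey : closure [set eta] y) a :
  cospecialization ey a = 0 -> a = 0.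
Proof.
move=> ea0.
have [U [A [chi [Uy Uchart]]]] := Y_scheme y.
have [Uo [Uh [Up [Uinj [Ub Uloc]]]]] := Uchart.
have Ueta : U eta := closure_point_near ey (open_nbhs_nbhs (conj Uo Uy)).
have [_ /(_ a)[c [b [bN acb]]] _] := Uloc _ Uy.
have bU : chi b y \is a GRing.unit by apply/negPn/negP.
have [Uz _ Us] := Uh _ Uy.
apply: (mulIr bU); rewrite mul0r acb.
suff -> : c = 0 by have := Uz 0 0; rewrite subrr => ->; rewrite subrr.
apply/eqP/negPn/negP => c0.
have := generic_chart_unit Uchart Ueta c0.
rewrite -(cospecialization_section ey (Us c)) -acb rmorphM /= ea0 mul0r.
by rewrite unitr0.
Qed.

Lemma cospecialization_generic_inj (y : Y) (ey : closure [set eta] y) :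
  injective (cospecialization ey).
Proof.
move=> a b ab; apply/eqP; rewrite -subr_eq0; apply/eqP.
by apply: (cospecialization_generic_eq0 (ey := ey)); rewrite rmorphB /= ab subrr.
Qed.


(** * Orders of vanishing along prime divisors *)

Hypothesis Y_regular : regular_scheme Y.

Lemma prime_divisor_dvr P :
  prime_divisor P -> exists t : stalk Y P, discrete_valuation_ring t.
Proof. exact/dim1_regular_dvr/Y_regular.2. Qed.

Local Notation germ P := (cospecialization (generic_closure P)).

Lemma germ_inj P : injective (cospecialization (generic_closure P)).
Proof. exact: cospecialization_generic_inj. Qed.

Lemma dvr_germ_unit P (t : stalk Y P) :
  discrete_valuation_ring t -> germ P t \is a GRing.unit.
Proof.
move=> [_ t0 _]; apply: function_field_unit; apply: contra_neq t0 => t0.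
exact: (cospecialization_generic_eq0 t0).
Qed.

(** The uniformizer hidden in [ord_eq] differs from the fixed [t] by a unit only, so the condition
    becomes that [f / t ^ n] is regular at [P]. *)
Lemma ord_geP P (t : stalk Y P) (f : stalk Y eta) n :
  discrete_valuation_ring t ->
  ord_ge P f n <-> exists c, f = germ P c * germ P t ^ n.
Proof.
move=> tP; have [tU t0 tdec] := tP; have tK := dvr_germ_unit tP.
split=> [[->|[m [s [u [s' [u' [i [j [sU uU]]]]]]]]]|[c ->]].
- by exists 0; rewrite rmorph0 mul0r.
- move=> /(germ_fractionP (generic_closure P)) ->.
  move=> /(germ_fractionP (generic_closure P)) ->.
  move=> -[fsj ->] nm.
  have [v sE] := (uniformizerP s tU).1 (uniformizer_nonunit sU).
  have [w tE] := (uniformizerP t sU).1 (uniformizer_nonunit tU).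
  (* Here [v * w * t = t], and [t] cancels in the function field. *)
  have vU : v \is a GRing.unit.
    apply/unitrPr; exists w; apply: germ_inj; apply: (mulIr tK).
    by rewrite -!rmorphM mul1r {2}tE sE; congr (germ P _); ring.
  have vK : germ P v \is a GRing.unit by rewrite rmorph_unit.
  have sK : germ P s \is a GRing.unit by rewrite sE rmorphM unitrM vK.
  have [k ijE] : exists k : nat, i%:Z - j%:Z = k%:Z + n.
    by exists `|(i%:Z - j%:Z - n)%R|%N; rewrite gez0_abs ?subr_ge0// subrK.
  exists (u * v ^ (i%:Z - j%:Z) * t ^+ k).
  rewrite !rmorphM rmorphXz// rmorphXn/=.
  by apply: rescale_power ijE _; rewrite -?rmorphM -?sE.
- have [->|c0] := eqVneq c 0; first by left; rewrite rmorph0 mul0r.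
  have [u [k [uU ->]]] := tdec _ c0; right; exists (k%:Z + n); last first.
    by rewrite lerDr.
  have [i [j ijE]] : exists i j : nat, k%:Z + n = i%:Z - j%:Z.
    case: (k%:Z + n) => m; first by exists m, 0%N; rewrite subr0.
    by exists 0%N, m.+1; rewrite sub0r NegzE.
  exists t, u, (germ P t), (germ P u), i, j; split=> //.
  - exact/(germ_fractionP (generic_closure P)).
  - exact/(germ_fractionP (generic_closure P)).
  split=> //; rewrite rmorphM rmorphXn -!mulrA; congr (_ * _).
  have iE : (i : int) = k%:Z + n + j by rewrite ijE subrK.
  by rewrite [RHS]exprnP iE !(exprzDr tK) -!exprnP mulrA.
Qed.

Lemma ord_ge_le P f m n : m <= n -> ord_ge (eta := eta) P f n -> ord_ge P f m.
Proof.
by move=> mn [->|[k kf nk]]; [left|right; exists k; rewrite // (le_trans mn)].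
Qed.

Lemma ord_geD P (f g : stalk Y eta) n :
  prime_divisor P -> ord_ge P f n -> ord_ge P g n -> ord_ge P (f + g) n.
Proof.
move=> /prime_divisor_dvr[t tP]; rewrite !(ord_geP _ _ tP) => -[a ->] [b ->].
by exists (a + b); rewrite rmorphD mulrDl.
Qed.

Lemma ord_geN P (f : stalk Y eta) n :
  prime_divisor P -> ord_ge P f n -> ord_ge P (- f) n.
Proof.
move=> /prime_divisor_dvr[t tP]; rewrite !(ord_geP _ _ tP) => -[a ->].
by exists (- a); rewrite rmorphN mulNr.
Qed.

Lemma ord_geM P (f g : stalk Y eta) m n : prime_divisor P ->
  ord_ge P f m -> ord_ge P g n -> ord_ge P (f * g) (m + n).
Proof.
move=> /prime_divisor_dvr[t tP]; rewrite !(ord_geP _ _ tP) => -[a ->] [b ->].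
exists (a * b); rewrite rmorphM (exprzDr (dvr_germ_unit tP)).
by rewrite mulrACA.
Qed.

Lemma ord_geX P (f : stalk Y eta) m k : prime_divisor P ->
  ord_ge P f m -> ord_ge P (f ^+ k) (m *+ k).
Proof.
move=> Pp fm; elim: k => [|k IH]; last by rewrite exprS mulrS; apply: ord_geM.
have [t tP] := prime_divisor_dvr Pp; apply/(ord_geP _ _ tP).
by exists 1; rewrite rmorph1 mul1r.
Qed.

Lemma ord_ge_germ P (a : stalk Y P) : prime_divisor P -> ord_ge P (germ P a) 0.
Proof.
move=> /prime_divisor_dvr[t tP]; apply/(ord_geP _ _ tP).
by exists a; rewrite expr0z mulr1.
Qed.

Lemma ord_ge_nonunit P (a : stalk Y P) :
  prime_divisor P -> a \isn't a GRing.unit -> ord_ge P (germ P a) 1.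
Proof.
move=> /prime_divisor_dvr[t tP]; have [tU _ _] := tP.
move=> /(uniformizerP _ tU)[c ->]; apply/(ord_geP _ _ tP).
by exists c; rewrite rmorphM expr1z.
Qed.

(** The exact order is the exponent [k] in [a = u * t ^+ k]: a larger order would make the unit [u]
    a multiple of [t]. *)
Lemma ord_ge_exact P (a : stalk Y P) : prime_divisor P -> germ P a != 0 ->
  exists m, forall n, ord_ge P (germ P a) n <-> n <= m.
Proof.
move=> /prime_divisor_dvr[t tP] fa0; have [tU t0 tdec] := tP.
have tK := dvr_germ_unit tP.
have a0 : a != 0 by apply: contra_neq fa0 => ->; rewrite rmorph0.
have [u [k [uU ->]]] := tdec _ a0; exists (k%:Z) => n.
split=> [|nk]; last first.
  apply: ord_ge_le nk _; apply/(ord_geP _ _ tP); exists u.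
  by rewrite rmorphM rmorphXn.
move=> /(ord_geP _ _ tP)[c]; rewrite leNgt => acE; apply/negP => kn.
have [l nE] : exists l : nat, n = k%:Z + l.+1.
  exists `|(n - k%:Z - 1)%R|%N; lia.
suff : u \isn't a GRing.unit by rewrite uU.
apply/(uniformizerP _ tU); exists (c * t ^+ l); apply: germ_inj.
apply: (mulIr (unitrX k tK)); move: acE; rewrite !rmorphM !rmorphXn /= => ->.
by rewrite nE (exprzDr tK) -!exprnP exprSr; ring.
Qed.

(** * Local equations of prime divisors *)

(** If some [a] were a unit at [E] but not at [P], the uniformizer [t] at [P] would become a unit at
    [E], and so would every nonzero germ at [P]. The numerator of a uniformizer at [E] contradicts
    this. *)
Lemma prime_divisor_specialization (P E : Y) : prime_divisor P -> prime_divisor E ->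
  closure [set E] P -> P = E.
Proof.
move=> Pp Ep EP.
have [U [A [chi [UP Uchart]]]] := Y_scheme P.
have [Uo [Uh [Up [Uinj [Ub Uloc]]]]] := Uchart.
have UE : U E := closure_point_near EP (open_nbhs_nbhs (conj Uo UP)).
have [_ _ Us] := Uh _ UP.
have chiE a : chi a E = cospecialization EP (chi a P).
  by rewrite cospecialization_section.
have unitE a : chi a P \is a GRing.unit -> chi a E \is a GRing.unit.
  by rewrite chiE; exact: rmorph_unit.
apply: (Uinj _ _ UP UE) => a; apply/idP/idP => [/unitE//|aE].
apply: contraT => aP.
have [t [tU t0 tdec]] := prime_divisor_dvr Pp.
have [w [wU w0 _]] := prime_divisor_dvr Ep.
have neq0 b : chi b E != 0 -> chi b P != 0.
  by apply: contra_neq => b0; rewrite chiE b0 rmorph0.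
have [u [k [uU aE']]] : exists u k, u \is a GRing.unit /\ chi a P = u * t ^+ k.
  by apply/tdec/neq0; apply: contraTneq aE => ->; rewrite unitr0.
have [_ /(_ w)[b [c [cN wcb]]] _] := Uloc _ UE.
have cU : chi c E \is a GRing.unit by apply/negPn/negP.
have [|v [l [vU bE']]] := tdec (chi b P).
  apply/neq0; rewrite -wcb; apply: contra_neq w0 => wc0.
  by apply: (mulIr cU); rewrite mul0r.
have tE : cospecialization EP t \is a GRing.unit.
  move: aE aP; rewrite chiE aE' rmorphM rmorphXn unitrM => /andP[_].
  case: k {aE'} => [|k]; first by rewrite mulr1 uU.
  by rewrite unitrX_pos.
have : chi b E \is a GRing.unit.
  by rewrite chiE bE' rmorphM rmorphXn unitrM rmorph_unit//= unitrX.
by rewrite -wcb unitrM (negPf (uniformizer_nonunit wU)).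
Qed.

Lemma unit_generization (s : forall z, stalk Y z) (E z : Y) :
  section_at z s -> closure [set E] z ->
  s z \is a GRing.unit -> s E \is a GRing.unit.
Proof.
by move=> zs Ez sU; rewrite -(cospecialization_section Ez zs) rmorph_unit.
Qed.

(** Spreads the generator [x] out from [y]. The prime of [E] in a noetherian chart has finitely many
    generators [e i], each a multiple of [x] at [y], so on one common neighbourhood all are
    multiples of a section [s] extending [x]. *)
Lemma local_equation (E y : Y) (x : stalk Y y) : closure [set E] y ->
  prime_ideal_stalk E (y := y) = ideal_span [set x] ->
  exists s W, [/\ open W, W y, s y = x,
    (forall z, W z -> section_at z s /\
       (s z \isn't a GRing.unit -> closure [set E] z)) & uniformizer (s E)].
Proof.
move=> Ey Ix.
have [U [A [chi [Uy Uchart Anoe]]]] := Y_regular.1 y.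
have [Uo [Uh [Up [Uinj [Ub Uloc]]]]] := Uchart.
have Un : nbhs y U := open_nbhs_nbhs (conj Uo Uy).
have UE : U E := closure_point_near Ey Un.
pose p := [set a | chi a E \isn't a GRing.unit].
have pP : prime_ideal p by apply/Up; exists E.
have [pI _ _] := pP; have [n [e eE]] := Anoe p pI.
have pe i : p (e i).
  rewrite eE; exists 1%N, (fun=> 1), (fun=> e i); split; first by exists i.
  by rewrite big_ord_recl big_ord0 addr0 mul1r.
have chi_section a z : U z -> section_at z (chi a).
  by move=> /Uh[_ _]; apply.
have ex i : exists c, chi (e i) y = c * x.
  apply/ideal_span1P; rewrite -Ix; exists (chi (e i)); split=> //.
    exact: chi_section.
  near=> z => Ez; apply: contraNN (pe i); apply: unit_generization => //.
  by apply: chi_section; near: z.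
have {ex}[c ec] := choice ex.
have : prime_ideal_stalk E x.
  by rewrite Ix; apply/ideal_span1P; exists 1; rewrite mul1r.
move=> [s [sy sx sE]].
pose g i := germ_extension (c i).
have near_e : \forall z \near y, forall i, chi (e i) z = g i z * s z.
  apply: filter_forall => i; apply: section_germ.
  - exact: chi_section.
  - by apply: section_mul => //; exact: germ_extension_section.
  - by rewrite /g germ_extensionE sx.
have nearW : \forall z \near y, [/\ U z, section_at z s,
    (closure [set E] z -> s z \isn't a GRing.unit) &
    forall i, chi (e i) z = g i z * s z].
  by near=> z; split; near: z => //; exact: section_near.
have [W [Wo Wy] WP] := near_open nearW.
exists s, W; split=> // [z Wz|].
  (* Where [s] vanishes, so do all the [e i], and hence the whole prime [p]. A basic open set around
     [z] therefore contains [E]. *)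
  have [Uz zs _ ez] := WP _ Wz; split=> // sN V /(Ub _ _ Uz)[a [aU aV]].
  exists E; split=> //; apply: aV => //; apply: contraT => aE.
  have pz : prime_ideal [set b | chi b z \isn't a GRing.unit] by apply/Up; exists z.
  have [pzI _ _] := pz; have [_ _ pzM] := pzI.
  suff : [set b | chi b z \isn't a GRing.unit] a by move=> /=; rewrite aU.
  have : p a by [].
  rewrite eE => -[m [b [f [fe ->]]]]; apply: ideal_sum => // i; apply: pzM.
  by have [j _ <-] := fe i; rewrite /= ez unitrM (negPf sN) andbF.
have WE : W E := closure_point_near Ey (open_nbhs_nbhs (conj Wo Wy)).
have [_ _ /(_ (@subset_closure _ _ _ erefl)) sEN eE'] := WP _ WE.
apply/seteqP; split=> [w wN|w /ideal_span1P[v ->]]; last first.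
  by rewrite /nonunits /= unitrM (negPf sEN) andbF.
(* A nonunit [w] at [E] is a fraction with numerator in [p], a combination of the [e i] and thus a
   multiple of [s E]. *)
have [_ /(_ w)[a [b [bN wba]]] _] := Uloc _ UE.
have bU : chi b E \is a GRing.unit by apply/negPn/negP.
have pa : p a by rewrite /p /= -wba unitrM (negPf wN).
have [Uz [U1 UM] _] := Uh _ UE.
suff [v av] : exists v, chi a E = v * s E.
  apply/ideal_span1P; exists (v / chi b E).
  by apply: (mulIr bU); rewrite wba av mulrAC divrK.
apply/ideal_span1P; move: pa; rewrite eE => -[m [h [f [fe ->]]]].
pose I := [set q | ideal_span [set s E] (chi q E)].
suff : I (\sum_i h i * f i) by [].
have chi0 : chi 0 E = 0 by have := Uz 0 0; rewrite !subrr.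
have chiD u v : chi (u + v) E = chi u E + chi v E.
  have chiN q : chi (- q) E = - chi q E.
    by rewrite -sub0r (Uz 0 q) chi0 sub0r.
  by rewrite -[v]opprK (Uz u (- v)) !chiN opprK.
apply: ideal_sum; first split.
- by apply/ideal_span1P; exists 0; rewrite mul0r.
- move=> q r /ideal_span1P[q' qE] /ideal_span1P[r' rE].
  by apply/ideal_span1P; exists (q' + r'); rewrite chiD qE rE mulrDl.
- move=> q r /ideal_span1P[r' rE].
  by apply/ideal_span1P; exists (chi q E * r'); rewrite -mulrA -rE; exact: UM.
- move=> i; have [j _ <-] := fe i.
  apply/ideal_span1P; exists (chi (h i) E * g j E).
  by rewrite -mulrA -eE'; exact: UM.
Unshelve. all: by end_near.
Qed.

(** * Sections of [O_Y(-D)] restricted to a prime divisor *)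

Lemma germE P s : section_at P s -> germ P (s P) = s eta.
Proof. exact: cospecialization_section. Qed.

(** At the point [E] itself, a factor from the ideal of [E] is a nonunit of the stalk and adds one
    to the order. *)
Lemma ord_ge_restriction_ideal (E : Y) (D : Y -> int) (f : stalk Y eta) :
  prime_divisor E -> prime_ideal_OYN_stalk E D E f -> ord_ge E f (D E + 1).
Proof.
move=> Ep [n [a [a' [l [al ->]]]]].
apply: (big_ind (fun h => ord_ge E h (D E + 1))) => [|g h|i _]; first by left.
  exact: ord_geD.
have [[s [Es sa sN]] aa' [V [_ VE lV]]] := al i.
rewrite ((germ_fractionP (generic_closure E) _ _).1 aa').
rewrite addrC; apply: ord_geM => //; last exact: lV.
apply: ord_ge_nonunit => //; rewrite -sa.
exact: (nbhs_singleton sN (@subset_closure _ _ _ erefl)).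
Qed.

Lemma restriction_idealD (E : Y) (D : Y -> int) (y : Y) (f g : stalk Y eta) :
  prime_ideal_OYN_stalk E D y f -> prime_ideal_OYN_stalk E D y g ->
  prime_ideal_OYN_stalk E D y (f + g).
Proof.
move=> [m [a [a' [l [al ->]]]]] [n [b [b' [k [bk ->]]]]].
pose join T (u : 'I_m -> T) (v : 'I_n -> T) (i : 'I_(m + n)) :=
  match fintype.split i with inl j => u j | inr j => v j end.
exists (m + n)%N, (join _ a b), (join _ a' b'), (join _ l k); split.
  by move=> i; rewrite /join; case: (fintype.split i).
rewrite big_split_ord; congr (_ + _); apply: eq_bigr => i _; rewrite /join.
  by rewrite (unsplitK (inl i)).
by rewrite (unsplitK (inr i)).
Qed.

Lemma ord_ge_inv_unit P (a : stalk Y P) : prime_divisor P ->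
  a \is a GRing.unit -> ord_ge P (germ P a)^-1 0.
Proof. by move=> Pp aU; rewrite -rmorphV//; exact: ord_ge_germ. Qed.

Lemma uniformizer_germ_unit P (x : stalk Y P) :
  prime_divisor P -> uniformizer x -> germ P x \is a GRing.unit.
Proof.
move=> /prime_divisor_dvr[t [tU t0 _]] xU; apply: function_field_unit.
have [w tE] := (uniformizerP t xU).1 (uniformizer_nonunit tU).
apply: contra_neq t0 => /cospecialization_generic_eq0 x0.
by rewrite tE x0 mulr0.
Qed.

Lemma ord_ge_inv_uniformizer P (x : stalk Y P) : prime_divisor P ->
  uniformizer x -> ord_ge P (germ P x)^-1 (- 1).
Proof.
move=> Pp xU; have [t tP] := prime_divisor_dvr Pp; have [tU _ _] := tP.
have [w tE] := (uniformizerP t xU).1 (uniformizer_nonunit tU).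
have tK := dvr_germ_unit tP; have xK := uniformizer_germ_unit Pp xU.
apply/(ord_geP _ _ tP); exists w; apply: (mulIr xK).
by rewrite mulVr// exprN1 mulrAC -rmorphM -tE divrr.
Qed.

(* A local equation [x] of [E] divides [f] in [O_Y(-D)] as soon as [f] vanishes
   along [E] to order greater than [D E]: near [y], no other prime divisor
   meets the zeros of [x]. *)
Lemma restriction_ideal_ord_ge (E : Y) (D : Y -> int) (y : Y) V
    (x : stalk Y y) (f : stalk Y eta) : prime_divisor E ->
  closure [set E] y -> prime_ideal_stalk E (y := y) = ideal_span [set x] ->
  open V -> V y -> OYN_sections D V f -> ord_ge E f (D E + 1) ->
  prime_ideal_OYN_stalk E D y f.
Proof.
move=> Ep Ey Ix Vo Vy fV fE.
have [s [W [Wo Wy sx WP sU]]] := local_equation Ey Ix.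
have WE : W E := closure_point_near Ey (open_nbhs_nbhs (conj Wo Wy)).
have sK : s eta \is a GRing.unit.
  by rewrite -(germE (WP _ WE).1); exact: uniformizer_germ_unit.
exists 1%N, (fun=> x), (fun=> s eta), (fun=> f / s eta); split; last first.
  by rewrite big_ord_recl big_ord0 addr0 mulrCA divrr// mulr1.
move=> _; split.
- by rewrite Ix; apply/ideal_span1P; exists 1; rewrite mul1r.
- apply/(germ_fractionP (generic_closure y)).
  by rewrite -sx germE//; exact: (WP _ Wy).1.
- exists (V `&` W); split=> // [|P [VP WPP] Pp]; first exact: openI.
  have [Ps sN] := WP _ WPP; rewrite -(germE Ps).
  have [sPU|/sN EP] := boolP (s P \is a GRing.unit).
    rewrite -[D P]addr0; apply: ord_geM => //; first exact: fV.
    exact: ord_ge_inv_unit.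
  have PE := prime_divisor_specialization Pp Ep EP; subst P.
  rewrite -[D E](addrK 1); apply: ord_geM => //.
  exact: ord_ge_inv_uniformizer.
Qed.

(** The same [tau] represents sections of both sheaves. Were its germ at [E] zero for [D], it would
    have order at least [D E + 1]. So would a local section [f] representing [tau] near [y], and the
    local equation of [E] would make [tau] vanish at [y] for [D']. *)
Lemma H0_nonzero_le (E : Y) (D D' : Y -> int) : prime_divisor E ->
  (forall y, closure [set E] y ->
     exists x, prime_ideal_stalk E (y := y) = ideal_span [set x]) ->
  div_le D D' -> D E = D' E -> H0_nonzero eta E D' -> H0_nonzero eta E D.
Proof.
move=> Ep Eloc DD' DE [tau tauD' [y Ey tauy]].
have secD (C C' : Y -> int) V f : div_le C C' -> OYN_sections (eta := eta) C' V f ->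
    OYN_sections C V f.
  by move=> CC' fV P VP Pp; apply: ord_ge_le (CC' P) _; exact: fV.
exists tau => [z Ez|].
  have [V [f [Vo Vz fV tauf]]] := tauD' z Ez.
  exists V, f; split=> // [|w Vw Ew]; first exact: secD fV.
  have [n [a [a' [l [al taul]]]]] := tauf w Vw Ew.
  exists n, a, a', l; split=> // i; have [? ? [V' [? ? lV']]] := al i.
  by split=> //; exists V'; split=> //; exact: secD lV'.
have EE : closure [set E] E by exact: subset_closure.
exists E => // /(ord_ge_restriction_ideal Ep) tauE; apply: tauy.
have [V [f [Vo Vy fV tauf]]] := tauD' y Ey.
have VE : V E := closure_point_near Ey (open_nbhs_nbhs (conj Vo Vy)).
rewrite -(subrK f (tau y)); apply: restriction_idealD; first exact: tauf.
have [x Ix] := Eloc y Ey; apply: (restriction_ideal_ord_ge _ Ey Ix Vo) => //.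
(* Write [f] as [tau E - (tau E - f)]: both terms have order at least [D' E + 1]. *)
rewrite -(subKr (tau E) f); apply: ord_geD => //; first by rewrite -DE.
by apply: ord_geN => //; apply: ord_ge_restriction_ideal => //; exact: tauf.
Qed.

Lemma H0_nonzero_section (E : Y) (D : Y -> int) (f : stalk Y eta) :
  prime_divisor E -> OYN_sections D [set: Y] f -> ~ ord_ge E f (D E + 1) ->
  H0_nonzero eta E D.
Proof.
move=> Ep fD fE; exists (fun=> f) => [y _|].
  exists [set: Y], f; split=> // [|z _ _]; first exact: openT.
  exists 0%N, (fun=> 0), (fun=> 0), (fun=> 0); split; first by case.
  by rewrite subrr big_ord0.
exists E; first exact: subset_closure.
by move=> /(ord_ge_restriction_ideal Ep).
Qed.

End generic.
Arguments generic_closure {Y eta} _ _.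

(** * Functions pulled back from [X] and antieffective divisors above [D] *)

Lemma section_exp (X : lrspace) (x : X) s n :
  section_at x s -> section_at x (fun z => s z ^+ n).
Proof.
move=> xs; elim: n => [|n IH]; first exact: section_1.
by apply: section_ext (section_mul xs IH) _; apply: nearW => z; rewrite exprS.
Qed.

Section log_resolution.
Variables (R : comUnitRingType) (X Y : lrspace).
Variables (chi : R -> forall x : X, stalk X x) (pi : morphism Y X) (eta : Y).
Hypotheses (Y_scheme : scheme Y) (Y_integral : integral_scheme Y).
Hypotheses (eta_generic : generic_point eta) (Y_regular : regular_scheme Y).
Hypothesis X_spec : affine_chart [set: X] chi.

Definition pullback (r : R) (y : Y) : stalk Y y :=
  mor_stalk pi y (chi r (pi y)).

Lemma pullback_section r y : section_at y (pullback r).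
Proof. by apply: mor_section; have [_ [/(_ (pi y) I)[_ _]]] := X_spec. Qed.

(* A uniformizer at [P] is a fraction of pullbacks since [pi] is birational;
   its numerator vanishes at [P]. *)
Lemma pullback_vanishing (P : Y) : birational pi eta -> prime_divisor P ->
  exists2 r, pullback r eta != 0 & pullback r P \isn't a GRing.unit.
Proof.
move=> [pi_eta [inv _ invK]] Pp.
have [t tP] := prime_divisor_dvr Y_regular Pp; have [tU t0 _] := tP.
have [_ [_ [_ [_ [_ /(_ _ I) Xloc]]]]] := X_spec.
have tK := dvr_germ_unit Y_scheme Y_integral eta_generic tP.
pose t' := cospecialization (generic_closure eta_generic P) t.
have [_ /(_ (inv t'))[a [b [bN tba]]] _] := Xloc (pi eta).
have bK : pullback b eta \is a GRing.unit.
  by apply: rmorph_unit; apply/negPn/negP.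
have tE : t' * pullback b eta = pullback a eta.
  by rewrite /pullback -tba rmorphM/= invK.
have tPE : t * pullback b P = pullback a P.
  apply: (cospecialization_generic_inj Y_scheme Y_integral eta_generic
    (ey := generic_closure eta_generic P)).
  rewrite rmorphM/= !(cospecialization_section _ (pullback_section _ _)).
  exact: tE.
exists a; last by rewrite -tPE unitrM (negPf (uniformizer_nonunit tU)).
apply: contraTneq tK => a0; rewrite -/t'.
suff -> : t' = 0 by rewrite unitr0.
by apply: (mulIr bK); rewrite tE a0 mul0r.
Qed.

(** Multiply, for each [Q] in the list, by the power [|D Q|] of a pulled back function vanishing at
    [Q]. All factors are regular everywhere, so the bounds already obtained persist. *)
Lemma exists_section_ord_ge (D : Y -> int) (s : seq Y) : birational pi eta ->
  (forall P, P \in s -> prime_divisor P) ->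
  exists g : forall y, stalk Y y, [/\ forall y, section_at y g, g eta != 0 &
    forall P, P \in s -> ord_ge P (g eta) (D P)].
Proof.
move=> pi_bir; elim: s => [|Q s IH] sP.
  exists (fun=> 1); split=> //; first exact: section_1.
  exact: oner_neq0.
have [|g [gS g0 gD]] := IH.
  by move=> P Ps; apply: sP; rewrite in_cons Ps orbT.
have [r r0 rQ] := pullback_vanishing pi_bir (sP Q (mem_head _ _)).
have gU := function_field_unit Y_scheme Y_integral eta_generic g0.
have rU := function_field_unit Y_scheme Y_integral eta_generic r0.
have ordM := ord_geM Y_scheme Y_integral eta_generic Y_regular.
have ordX := ord_geX Y_scheme Y_integral eta_generic Y_regular.
have ord0 P (h : forall y, stalk Y y) : prime_divisor P -> section_at P h ->
    ord_ge P (h eta) 0.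
  move=> Pp Ph; rewrite -(germE eta_generic Ph).
  exact: ord_ge_germ.
exists (fun y => g y * pullback r y ^+ `|D Q|%N); split.
- move=> y; apply: section_mul => //; apply: section_exp.
  exact: pullback_section.
- have : g eta * pullback r eta ^+ `|D Q|%N \is a GRing.unit.
    by rewrite unitrM gU unitrX.
  by apply: contraTneq => ->; rewrite unitr0.
- move=> P Ps; have Pp := sP P Ps; move: Ps; rewrite in_cons => /predU1P[PQ|Ps].
    subst P; apply: (@ord_ge_le _ _ _ _ _ (0 + 1 *+ `|D Q|%N)).
      by rewrite add0r pmulrn intz; lia.
    apply: ordM => //; first exact: ord0.
    apply: ordX => //; rewrite -(germE eta_generic (pullback_section r Q)).
    exact: ord_ge_nonunit.
  rewrite -[D P]addr0; apply: ordM => //; first exact: gD.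
  rewrite -(mul0rn _ `|D Q|%N); apply: ordX => //; apply: ord0 => //.
  exact: pullback_section.
Qed.

Lemma exists_antieffective_ge (D : Y -> int) : birational pi eta ->
  is_divisor (exceptional_divisor pi) -> is_divisor D ->
  exists D', [/\ is_divisor D', antieffective pi eta D' & div_le D D'].
Proof.
move=> pi_bir [Efin _] [Dfin Dp].
have [s sE] := (finite_seqP _).1 Dfin.
have sP P : (P \in s) = (D P != 0).
  have : [set` s] P <-> D P != 0 by rewrite -sE.
  by move=> [Ps DP]; apply/idP/idP.
have [P|g [gS g0 gD]] := exists_section_ord_ge D (s := s) pi_bir.
  by rewrite sP; exact: Dp.
(* [m P] is the order of [g] along [P], with the default 0 where [P] is not a prime divisor. *)
have [m mP] : {m : Y -> int & forall P, prime_divisor P ->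
    forall n, ord_ge P (g eta) n <-> n <= m P}.
  apply: (@choice _ _ (fun P k => prime_divisor P ->
    forall n, ord_ge P (g eta) n <-> n <= k)) => P.
  have [Pp|nPp] := pselect (prime_divisor P); last by exists 0.
  have : cospecialization (generic_closure eta_generic P) (g P) != 0.
    by rewrite (germE eta_generic).
  move=> /(ord_ge_exact Y_scheme Y_integral Y_regular Pp).
  by rewrite (germE eta_generic)// => -[k kP]; exists k.
have m_ge0 P : prime_divisor P -> 0 <= m P.
  move=> Pp; apply/mP => //; rewrite -(germE eta_generic (gS P)).
  exact: ord_ge_germ.
pose B := [set P | D P != 0] `|` [set P | exceptional_divisor pi P != 0].
have Bp P : B P -> prime_divisor P.
  case=> [/Dp//|]; rewrite /exceptional_divisor /=.
  by case: asboolP => [[]//|]; rewrite eqxx.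
(* Truncation to the finite set [B] makes finiteness of the support immediate. Since [m] is
   nonnegative on prime divisors, [g] remains a section of [O_Y(-D')]. *)
pose D' P := if `[< B P >] then m P else 0.
exists D'; split.
- split=> [|P]; last by rewrite /D'; case: asboolP => [/Bp//|]; rewrite eqxx.
  apply: (@sub_finite_set _ _ B); last by rewrite finite_setU.
  by move=> P /=; rewrite /D'; case: asboolP => //; rewrite eqxx.
- move=> E EE; have [Ep _] := EE.
  have BE : B E by right; rewrite /= /exceptional_divisor asboolT.
  (* Along [E] the order of [g] is exactly [m E = D' E], so [g] does not vanish there. *)
  apply: (H0_nonzero_section _ _ _ _ (f := g eta)) => //.
    move=> P _ Pp; apply/mP => //; rewrite /D'.
    by case: asboolP => // _; exact: m_ge0.
  by rewrite mP// /D' asboolT//; lia.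
- move=> P; rewrite /D'; case: asboolP => [BP|nBP].
    apply/mP; first exact: Bp.
    have [D0|D0] := eqVneq (D P) 0; last by apply: gD; rewrite sP.
    by apply/mP; [exact: Bp|rewrite D0; apply/m_ge0/Bp].
  have -> // : D P = 0.
  by apply/eqP/negPn/negP => DP; apply: nBP; left.
Qed.

End log_resolution.

(** * Unloading and its termination *)

Lemma is_divisor_add_prime (Y : lrspace) (D : Y -> int) (E : Y) :
  is_divisor D -> prime_divisor E -> is_divisor (div_add D (div_prime E)).
Proof.
move=> [Dfin Dp] Ep; split=> [|P].
  apply: (@sub_finite_set _ _ ([set P | D P != 0] `|` [set E])).
    move=> P /=; rewrite /div_add /div_prime.
    by have [->|_] := eqVneq P E; [right|rewrite addr0; left].
  by rewrite finite_setU; split=> //; exact: finite_set1.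
rewrite /div_add /div_prime; have [->//|_] := eqVneq P E.
by rewrite addr0; exact: Dp.
Qed.

Lemma simple_normal_crossing_local_equation (Y : lrspace) (D : Y -> int)
    (P y : Y) : simple_normal_crossing D -> D P != 0 -> closure [set P] y ->
  exists x, prime_ideal_stalk P (y := y) = ideal_span [set x].
Proof.
move=> [_ /(_ y)[d [x [_ xP]]]] DP Py.
by have [i ->] := xP P DP Py; exists (x i).
Qed.

Theorem proposition3p8 (k : closedFieldType) (R : comUnitAlgType k) (d : nat)
    (X Y : lrspace) (chi : R -> forall x : X, stalk X x) (a : set R)
    (pi : morphism Y X) (eta : Y)
    (k_char0 : [pchar k] =i pred0)
    (R_regular : regular_local_ring R)
    (R_dim : krull_dim R d) (d_ge2 : (2 <= d)%N)
    (R_germ : smooth_germ R)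
    (X_spec : affine_chart [set: X] chi)
    (a_ideal : ideal a) (a_neq0 : a <> [set 0])
    (Y_scheme : scheme Y) (Y_integral : integral_scheme Y)
    (eta_generic : generic_point eta)
    (pi_log_resolution : log_resolution chi a pi eta)
    (D : Y -> int) (D_divisor : is_divisor D) :
  forall Ds : nat -> Y -> int, Ds 0%N = D -> unloading_run pi eta Ds ->
    exists n : nat,
      (forall i : nat, (i < n)%N -> ~ antieffective pi eta (Ds i)) /\
      antieffective_closure pi eta D (Ds n).
Proof.
move=> Ds Ds0 run.
have [_ pi_bir Y_regular [Exc_div _] [F [_ F_eff _ _ snc]]] := pi_log_resolution.
(* As [F] is effective, every exceptional prime has a positive coefficient in the normal crossing
   divisor. *)
have Eloc E : exceptional_prime pi E -> forall y, closure [set E] y ->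
    exists x, prime_ideal_stalk E (y := y) = ideal_span [set x].
  move=> EE y; apply: (simple_normal_crossing_local_equation snc).
  have := F_eff E; rewrite /div_add /exceptional_divisor asboolT//; lia.
have unload_le C C' E : exceptional_prime pi E -> ~ H0_nonzero eta E C ->
    antieffective pi eta C' -> div_le C C' ->
    div_le (div_add C (div_prime E)) C' /\ C E < C' E.
  move=> EE CE C'anti CC'.
  have CEC' : C E < C' E.
    rewrite lt_neqAle CC' andbT; apply/eqP => CEE; apply: CE.
    have [Ep _] := EE.
    exact: (H0_nonzero_le Y_scheme Y_integral eta_generic Y_regular Ep
      (Eloc E EE) CC' CEE (C'anti E EE)).
  split=> // P; rewrite /div_add /div_prime.
  have [->|_] := eqVneq P E; first by move: CEC'; lia.
  by rewrite addr0; exact: CC'.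
have [B [B_div B_anti DB]] := exists_antieffective_ge Y_scheme Y_integral
  eta_generic Y_regular X_spec pi_bir Exc_div D_divisor.
have [s0 s0E] := (finite_seqP _).1 Exc_div.1.
(* Without repetitions, adding [E] changes exactly one term of a sum over [s]. *)
pose s := undup s0.
have sE E : exceptional_prime pi E -> E \in s.
  move=> EE; rewrite mem_undup; suff : [set` s0] E by [].
  by rewrite -s0E /= /exceptional_divisor asboolT.
(* The termination measure: the distance to [B] over the exceptional primes. One more copy of [E]
   lowers it, because [C] is still below [B] there. *)
have dist_lt C E : exceptional_prime pi E -> C E < B E ->
    (\sum_(P <- s) absz (B P - div_add C (div_prime E) P)
     < \sum_(P <- s) absz (B P - C P))%N.
  move=> /sE Es CB.
  rewrite !(bigD1_seq E) ?undup_uniq//= -addSn leq_add//.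
    by rewrite /div_add /div_prime eqxx; lia.
  rewrite leq_sum// => P PE.
  by rewrite /div_add /div_prime (negPf PE) addr0.
(* Induction on a bound [N] for the distance to [B]. The invariant keeps [Ds i] below every
   antieffective divisor above [D], so the first antieffective term is the closure. *)
suff unload N i : is_divisor (Ds i) -> div_le D (Ds i) ->
    (forall j, (j < i)%N -> ~ antieffective pi eta (Ds j)) ->
    (forall C, antieffective pi eta C -> div_le D C -> div_le (Ds i) C) ->
    (\sum_(P <- s) absz (B P - Ds i P) <= N)%N ->
    exists n : nat,
      (forall i : nat, (i < n)%N -> ~ antieffective pi eta (Ds i)) /\
      antieffective_closure pi eta D (Ds n).
  by apply: (unload _ 0%N _ _ _ _ (leqnn _)); rewrite ?Ds0 //.
(* With bound 0 a further step is impossible: it would bring the distance strictly below 0. *)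
elim: N i => [|N IH] i Di DDi before below distN;
  have [Danti|Dnanti] := pselect (antieffective pi eta (Ds i)); try
  (by exists i; split=> //; split=> // C _; exact: below);
  have [E [EE DE DsS]] := run i Dnanti;
  have [_ DEB] := unload_le _ _ _ EE DE B_anti (below B B_anti DB);
  have := dist_lt _ _ EE DEB; rewrite -DsS => dlt.
  by have := leq_trans dlt distN.
apply: (IH i.+1) => [||j|C Canti DC|].
- by rewrite DsS; apply: is_divisor_add_prime => //; have [] := EE.
- move=> P; apply: le_trans (DDi P) _; rewrite DsS /div_add lerDl.
  by rewrite /div_prime; case: eqP.
- by rewrite ltnS leq_eqVlt => /predU1P[->//|]; exact: before.
- by rewrite DsS; have [] := unload_le _ _ _ EE DE Canti (below C Canti DC).
- by rewrite -ltnS; exact: leq_trans distN.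
Qed.
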